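(* Let $V$ be a finite-dimensional Euclidean space and let $A, B \in L(V)$ be given. Assume that $K \subseteq V$ is a proper, self-dual cone satisfying the following assumption: for any $v, w \in \mathrm{int}(K)$ there exists a self-adjoint mapping $D\in L(V)$, acting diffusively on $K$, with $Dv = w$. Suppose that $A$ is quasi-monotone (QM) with respect to $K$, $B$ is $K$-nonnegative, and $A+B$ is stable. Then there exist $D, Q \in L(V)$ that act diffusively on $K$ such that $$\begin{pmatrix} A^*D+DA+Q & B^*D \\ DB & -Q \end{pmatrix} \prec 0,$$ where the block operator acts on the direct sum $V\oplus V$.
   Context: $V$ is a finite-dimensional real vector space with inner product $\langle \cdot,\cdot\rangle$; $L(V)$ is the space of linear mappings from $V$ to $V$; $A^*$ is the adjoint of $A$. $V\oplus V$ carries the inner product $\langle (x,y),(s,t)\rangle=\langle x,s\rangle+\langle y,t\rangle$. The notation $P\prec 0$ means that $P$ is self-adjoint and negative definite. A convex cone is a subset $K\subseteq V$ with $\alpha x+\beta y\in K$ for all $x,y\in K$ and $\alpha,\beta>0$. A proper cone is a convex cone that is closed, pointed ($K\cap(-K)=\{0\}$) and generating ($V=K-K$). $K$ is self-dual if $K=K^*$, where $K^*=\{y\in V:\langle x,y\rangle\ge 0 \text{ for all } x\in K\}$. $\mathrm{int}(K)$ is the interior of $K$. $T\in L(V)$ is quasi-monotone (QM) with respect to $K$ if $x,y\in K$ and $\langle x,y\rangle=0$ imply $\langle x,Ty\rangle\ge 0$. $T\in L(V)$ is $K$-nonnegative if $T(K)\subseteq K$. $D\in L(V)$ acts diffusively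 on (with respect to) $K$ if $D(K)\subseteq K$, and $x,y\in K$ with $\langle x,y\rangle=0$ implies $\langle x,Dy\rangle=0$. $T\in L(V)$ is stable if all eigenvalues (real or complex) of $T$ have negative real part. *)

(* Defs.v *)
From HB Require Import structures.
From mathcomp Require Import all_boot all_order all_algebra.
From mathcomp Require Import complex.
From mathcomp Require Import all_classical all_reals.
From mathcomp Require Import topology normedtype.
From mathcomp Require Import ring lra.

Set Implicit Arguments.
Unset Strict Implicit.
Unset Printing Implicit Defensive.

Import Order.TTheory GRing.Theory Num.Theory.
Import numFieldNormedType.Exports.

Local Open Scope classical_set_scope.
Local Open Scope ring_scope.

(* A real inner product on V is a positive definite symmetric bilinear form,
   that is, a term of type {dot V for idfun}. *)
Section InnerProduct.
Context {R : realType} {V : lmodType R}.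
Variable dot : {dot V for idfun}.

Lemma dotC (x y : V) : dot x y = dot y x.
Proof. by rewrite (hermitian_subproof x y) expr0 mul1r. Qed.

Lemma dotDl (x y z : V) : dot (x + y) z = dot x z + dot y z.
Proof.
have dB : zmod_morphism (dot ^~ z) := zmod_morphisml_subproof z.
have d0 : dot 0 z = 0 by have := dB 0 0; rewrite /= !subr0 subrr.
by have := dB x (- y); have := dB 0 y; rewrite /= opprK sub0r d0 sub0r => -> ->;
  rewrite opprK.
Qed.

Lemma dotZl (a : R) (x y : V) : dot (a *: x) y = a * dot x y.
Proof. exact: (linearl_subproof y). Qed.

Lemma dotDr (x y z : V) : dot x (y + z) = dot x y + dot x z.
Proof. by rewrite dotC dotDl !(dotC x). Qed.

Lemma dotZr (a : R) (x y : V) : dot x (a *: y) = a * dot x y.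
Proof. by rewrite dotC dotZl (dotC x). Qed.

Lemma dot0l (x : V) : dot 0 x = 0.
Proof. by rewrite -(scale0r 0) dotZl mul0r. Qed.

Lemma dot_gt0 (x : V) : x != 0 -> 0 < dot x x.
Proof. exact: neq0_dnorm_gt0. Qed.

Lemma dot_ge0 (x : V) : 0 <= dot x x.
Proof. by have [->|/dot_gt0/ltW//] := eqVneq x 0; rewrite dot0l. Qed.

Lemma dot_eq0 (x : V) : dot x x = 0 -> x = 0.
Proof.
by move=> d0; apply/eqP; apply: contraPT d0 => /dot_gt0; rewrite lt0r=> /andP[/eqP].
Qed.

Lemma dot_CauchySchwarz (x y : V) : dot x y ^+ 2 <= dot x x * dot y y.
Proof.
have [->|/dot_gt0 y_gt0] := eqVneq y 0; first by rewrite dotC !dot0l mulr0 expr0n.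
have := dot_ge0 (dot y y *: x + (- dot x y) *: y).
rewrite !(dotDl, dotDr, dotZl, dotZr) (dotC y x) => ge0.
rewrite -(ler_pM2l y_gt0) -subr_ge0; apply: le_trans ge0 _.
by rewrite le_eqVlt; apply/orP; left; apply/eqP; ring.
Qed.

End InnerProduct.

(* V with the topology of the norm sqrt <x, x>. *)
Definition euclid (R : realType) (V : lmodType R) (dot : {dot V for idfun})
  : Type := V.

Section Euclid.
Context {R : realType} {V : lmodType R}.
Variable dot : {dot V for idfun}.

HB.instance Definition _ := GRing.Lmodule.copy (euclid dot) V.

Let nrm (x : euclid dot) : R := Num.sqrt (dot x x).

Let nrmD (x y : euclid dot) : nrm (x + y) <= nrm x + nrm y.
Proof.
have s0 : 0 <= nrm x + nrm y by rewrite addr_ge0 ?sqrtr_ge0.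
rewrite -(ger0_norm s0) -sqrtr_sqr ler_sqrt ?sqr_ge0//.
rewrite sqrrD !sqr_sqrtr ?dot_ge0// !(dotDl, dotDr) (dotC dot y x).
have : dot x y <= nrm x * nrm y.
  rewrite -sqrtrM ?dot_ge0//; apply: le_trans (ler_norm _) _.
  by rewrite -sqrtr_sqr ler_sqrt ?mulr_ge0 ?dot_ge0// dot_CauchySchwarz.
by rewrite /nrm; lra.
Qed.

Let nrmZ (a : R) (x : euclid dot) : nrm (a *: x) = `|a| * nrm x.
Proof.
by rewrite /nrm dotZl dotZr mulrA -expr2 sqrtrM ?sqr_ge0// sqrtr_sqr.
Qed.

Let nrm0 (x : euclid dot) : nrm x = 0 -> x = 0.
Proof.
move=> /eqP; rewrite sqrtr_eq0 => d0; apply: (dot_eq0 (dot := dot)).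
by apply/eqP; rewrite eq_le d0 dot_ge0.
Qed.

HB.instance Definition _ := Lmodule_isNormed.Build R (euclid dot) nrmD nrmZ nrm0.

Lemma euclid_normE (x : euclid dot) : `|x| = Num.sqrt (dot x x).
Proof. by []. Qed.

End Euclid.

Section ProdDot.
Context {R : realType} {V : lmodType R}.
Variable dot : {dot V for idfun}.

Definition prod_dot (z w : V * V) : R := dot z.1 w.1 + dot z.2 w.2.

Let prod_dotC (z w : V * V) : prod_dot z w = (-1) ^+ false * idfun (prod_dot w z).
Proof. by rewrite expr0 mul1r /prod_dot /= !(dotC dot z.1) (dotC dot z.2). Qed.

Let prod_dot_linl (w : V * V) :
  GRing.linear_for ( *%R : R -> R -> R) (prod_dot ^~ w).
Proof.
by move=> a x y; rewrite /prod_dot /= !dotDl !dotZl mulrDr addrACA.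
Qed.

Let prod_dot_linr (z : V * V) :
  GRing.linear_for (idfun \; *%R : R -> R -> R) (prod_dot z).
Proof.
by move=> a x y; rewrite /prod_dot /= !dotDr !dotZr mulrDr addrACA.
Qed.

Let prod_dot_gt0 (z : V * V) : z != 0 -> 0 < prod_dot z z.
Proof.
case: z => x y; rewrite /prod_dot/= xpair_eqE negb_and => /orP[]n0.
  by rewrite ltr_pwDl ?dot_gt0 ?dot_ge0.
by rewrite ltr_wpDl ?dot_gt0 ?dot_ge0.
Qed.

HB.instance Definition _ :=
  bilinear_isBilinear.Build R _ _ R ( *%R) (idfun \; *%R) prod_dot
    (prod_dot_linl, prod_dot_linr).
HB.instance Definition _ :=
  isHermitianSesquilinear.Build R _ false idfun prod_dot prod_dotC.
HB.instance Definition _ := isDotProduct.Build R _ prod_dot prod_dot_gt0.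

End ProdDot.

Section Operators.
Context {R : realType} {V : vectType R}.
Implicit Types (dot : {dot V for idfun}) (T : 'End(V)).

Definition adjoint dot T : 'End(V) :=
  xget 0 [set T' : 'End(V) | forall x y, dot (T x) y = dot x (T' y)].

Lemma adjointP dot T (x y : V) : dot (T x) y = dot x (adjoint dot T y).
Proof.
move: x y; apply: (@xgetPex _ 0
  [set T' : 'End(V) | forall x y, dot (T x) y = dot x (T' y)]).
pose n := \dim {:V}; pose b := vbasis {:V}.
have lin_row (S : 'End(V)) : linear (fun y => \row_(i < n) dot (S b`_i) y).
  by move=> a x y; apply/rowP => i; rewrite !mxE dotDr dotZr.
pose coords (S : 'End(V)) : {linear V -> 'rV[R]_n} :=
  HB.pack (fun y => \row_(i < n) dot (S b`_i) y)
    (GRing.isLinear.Build _ _ _ _ _ (lin_row S)).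
pose phi : 'Hom(V, 'rV[R]_n) := linfun (coords \1%VF).
have ext (x y z : V) (S : 'End(V)) :
    (forall i : 'I_n, dot (S b`_i) y = dot b`_i z) -> dot (S x) y = dot x z.
  move=> eq_b; rewrite (coord_vbasis (memvf x)).
  rewrite linear_sum (@big_morph _ _ (dot ^~ y) 0 +%R) ?dot0l//;
    last by move=> u v; rewrite dotDl.
  rewrite (@big_morph _ _ (dot ^~ z) 0 +%R) ?dot0l//;
    last by move=> u v; rewrite dotDl.
  by apply: eq_bigr => i _; rewrite /= linearZ /= !dotZl eq_b.
have ker0 : lker phi == 0%VS.
  apply/lker0P => y z /rowP eq_yz; apply/eqP; rewrite -subr_eq0; apply/eqP.
  apply: (@dot_eq0 _ _ dot).
  have := ext (y - z) (y - z) 0 \1%VF.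
  rewrite id_lfunE (dotC dot _ 0) dot0l; apply=> i; rewrite (dotC dot _ 0) dot0l.
  have := eq_yz i; rewrite !lfunE /= !mxE !id_lfunE => eq_i.
  by rewrite dotDr -scaleN1r dotZr eq_i mulN1r subrr.
have phi_full : limg phi = fullv.
  apply/eqP; rewrite eqEdim subvf /= limg_dim_eq; last first.
    by move/eqP: ker0 => ->; rewrite capv0.
  by rewrite [X in (X <= _)%N]dimvf /dim /= mul1n.
exists (phi^-1 \o linfun (coords T))%VF => x y; apply: ext => i.
have : phi ((phi^-1 \o linfun (coords T))%VF y) = coords T y.
  by rewrite comp_lfunE limg_lfunVK ?phi_full ?memvf// lfunE.
by move/rowP => /(_ i); rewrite lfunE /= !mxE id_lfunE => <-.
Qed.

Definition self_adjoint dot T := adjoint dot T = T.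

Definition neg_definite dot T :=
  self_adjoint dot T /\ forall x : V, x != 0 -> dot (T x) x < 0.

(* The eigenvalues of T, real or complex, are those over R[i] of its matrix in
   a basis of V; mxof acts on row vectors on the right, as eigenvalue does. *)
Definition stable T :=
  forall z : R[i],
    eigenvalue (map_mx (real_complex R)
      (passmx.mxof (vbasis {:V}) (vbasis {:V}) T)) z ->
    complex.Re z < 0.

(* The operator on V (+) V with matrix of blocks (T11, T12; T21, T22). *)
Definition block_lfun (T11 T12 T21 T22 : 'End(V)) : 'End((V * V)%type) :=
  linfun (fun z : V * V => (T11 z.1 + T12 z.2, T21 z.1 + T22 z.2)).

Lemma block_lfunE (T11 T12 T21 T22 : 'End(V)) (z : V * V) :
  block_lfun T11 T12 T21 T22 z = (T11 z.1 + T12 z.2, T21 z.1 + T22 z.2).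
Proof.
have lin : linear (fun z : V * V => (T11 z.1 + T12 z.2, T21 z.1 + T22 z.2)).
  by move=> a [x y] [x' y']; congr pair; rewrite /= !linearP /= scalerDr addrACA.
pose f : {linear (V * V)%type -> (V * V)%type} :=
  HB.pack (fun z : V * V => (T11 z.1 + T12 z.2, T21 z.1 + T22 z.2))
    (GRing.isLinear.Build _ _ _ _ _ lin).
exact: (lfunE f).
Qed.

End Operators.

Section Cones.
Context {R : realType} {V : vectType R}.
Implicit Types (dot : {dot V for idfun}) (K : set V) (T D : 'End(V)).

Definition convex_cone K :=
  forall (x y : V) (a b : R), K x -> K y -> 0 < a -> 0 < b ->
    K (a *: x + b *: y).

Definition proper_cone dot K :=
  [/\ convex_cone K,
      closed (K : set (euclid dot)),
      K `&` [set - x | x in K] = [set 0] &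
      [set: V] = [set x - y | x in K & y in K]].

Definition dual_cone dot K : set V :=
  [set y | forall x, K x -> 0 <= dot x y].

Definition self_dual dot K := K = dual_cone dot K.

Definition cone_int dot K : set V := interior (K : set (euclid dot)).

Definition quasi_monotone dot K T :=
  forall x y, K x -> K y -> dot x y = 0 -> 0 <= dot x (T y).

Definition cone_nonnegative K T := T @` K `<=` K.

Definition acts_diffusively dot K D :=
  D @` K `<=` K /\
  forall x y, K x -> K y -> dot x y = 0 -> dot x (D y) = 0.

End Cones.

(* Main.v *)
Require Import Defs.
From HB Require Import structures.
From mathcomp Require Import all_boot all_order all_algebra.
From mathcomp Require Import complex.
From mathcomp Require Import all_classical all_reals.
From mathcomp Require Import topology normedtype derive.
From mathcomp Require Import ring lra.

Set Implicit Arguments.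
Unset Strict Implicit.
Unset Printing Implicit Defensive.

Import Order.TTheory GRing.Theory Num.Theory.
Import numFieldNormedType.Exports.
Local Open Scope classical_set_scope.
Local Open Scope ring_scope.

(** Put [T := A + B], which is quasi-monotone. Having no eigenvalue [s >= 0], it
    admits [v] in the interior of [K] with [- T v] in the interior, and so does
    [T^*] with some [w]. Choose [D v = w]; then [u := - T^* w - D (T v)] is
    interior, so that [Q v = D (B v) + u / 2] can be solved. The block operator
    [M] is self-adjoint, quasi-monotone for the self-dual cone [K x K], and
    [- M (v, v) = (u / 2, u / 2)] is interior, which by a Perron-Frobenius
    argument on the Rayleigh quotient forces [M] to be negative definite. *)

(** Let [t] tend to [0]. This serves both as closedness of a self-dual cone along segments and as a
    one-sided first order condition. *)
Lemma affine_ge0 (R : realFieldType) (a b : R) :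
  (forall t, 0 < t < 1 -> 0 <= a + t * b) -> 0 <= a.
Proof.
move=> ge0; rewrite leNgt; apply/negP => a0.
have d0 : 0 < 2 * (`|b| - a) by have := normr_ge0 b; lra.
(* At this [t] one has [t * b <= - a / 2], so [a + t * b <= a / 2 < 0]. *)
have t0 : 0 < - a / (2 * (`|b| - a)) by rewrite divr_gt0 ?oppr_gt0.
have : 0 < - a / (2 * (`|b| - a)) < 1.
  by rewrite t0 ltr_pdivrMr//; have := normr_ge0 b; lra.
move=> /ge0; have := ler_wpM2l (ltW t0) (ler_norm b).
have : - a / (2 * (`|b| - a)) * `|b| <= - a / 2.
  rewrite mulrAC ler_pdivrMr//.
  rewrite [leRHS](_ : _ = - a * (`|b| - a)); last by field.
  by apply: ler_wpM2l; lra.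
by lra.
Qed.

(** The coordinate row of [x], mapped into [R[i]], is an eigenvector of the matrix in [stable]. *)
Lemma real_eigenvector_lt0 (R : realType) (V : vectType R) (T : 'End(V))
    (s : R) (x : V) :
  stable T -> T x = s *: x -> x != 0 -> s < 0.
Proof.
move=> T_stable Tx x0; apply: (T_stable s%:C%C).
have bV := vbasisP {:V}.
apply/eigenvalueP; exists (map_mx (real_complex R) (passmx.rVof (vbasis {:V}) x)).
  rewrite -map_mxM -passmx.rVof_app// Tx; apply/rowP => i.
  by rewrite !mxE linearZ rmorphM.
by rewrite map_mx_eq0 passmx.rVof_eq0.
Qed.

(** * Inner product, adjoints and coordinate functionals *)

Section Dot.
Context {R : realType} {V : vectType R}.
Variable dot : {dot V for idfun}.
Implicit Types (x y z : V) (T : 'End(V)).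

Lemma dot0r x : dot x 0 = 0.
Proof. by rewrite dotC dot0l. Qed.

Lemma dotNl x y : dot (- x) y = - dot x y.
Proof. by rewrite -scaleN1r dotZl mulN1r. Qed.

Lemma dotNr x y : dot x (- y) = - dot x y.
Proof. by rewrite dotC dotNl dotC. Qed.

Lemma dot_suml (I : Type) (r : seq I) (P : pred I) (F : I -> V) y :
  dot (\sum_(i <- r | P i) F i) y = \sum_(i <- r | P i) dot (F i) y.
Proof.
by rewrite (@big_morph _ _ (dot ^~ y) 0 +%R) ?dot0l// => u v; rewrite dotDl.
Qed.

Lemma dot_sumr (I : Type) (r : seq I) (P : pred I) (F : I -> V) y :
  dot y (\sum_(i <- r | P i) F i) = \sum_(i <- r | P i) dot y (F i).
Proof. by rewrite dotC dot_suml; apply: eq_bigr => i _; rewrite dotC. Qed.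

Lemma dot_nondegenerate x y : (forall z, dot z x = dot z y) -> x = y.
Proof.
move=> e; apply/eqP; rewrite -subr_eq0; apply/eqP/(dot_eq0 (dot := dot)).
by rewrite dotDr dotNr e subrr.
Qed.

Lemma adjoint_unique T T' :
  (forall x y, dot (T x) y = dot x (T' y)) -> adjoint dot T = T'.
Proof.
by move=> e; apply/lfunP => y; apply: dot_nondegenerate => x; rewrite -adjointP.
Qed.

Lemma adjointD T T' : adjoint dot (T + T') = adjoint dot T + adjoint dot T'.
Proof.
by apply: adjoint_unique => x y; rewrite !lfunE/= dotDl dotDr -!adjointP.
Qed.

Lemma self_adjointP T :
  self_adjoint dot T -> forall x y, dot (T x) y = dot x (T y).
Proof. by move=> e x y; rewrite adjointP e. Qed.

Lemma dot_le_sqrt x y :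
  dot x y <= Num.sqrt (dot x x) * Num.sqrt (dot y y).
Proof.
rewrite -sqrtrM ?dot_ge0//; apply: le_trans (ler_norm _) _.
by rewrite -sqrtr_sqr ler_sqrt ?mulr_ge0 ?dot_ge0// dot_CauchySchwarz.
Qed.

(** Riesz representation: the adjoint of the rank one map [x |-> coord b i x *: e] sends [e] to
    [<e, e>] times the representing vector. *)
Lemma coord_riesz (i : 'I_(\dim {:V})) :
  exists r, forall x, coord (vbasis {:V}) i x = dot x r.
Proof.
pose b := vbasis {:V}; pose e := b`_i.
have e0 : e != 0.
  have /free_not0 := basis_free (vbasisP {:V}); apply.
  by rewrite mem_nth// size_tuple.
have lin : linear (fun x => coord b i x *: e).
  by move=> a x y; rewrite linearP /= scalerDl scalerA.
pose f : {linear V -> V} := HB.pack (fun x => coord b i x *: e)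
  (GRing.isLinear.Build _ _ _ _ _ lin).
exists ((dot e e)^-1 *: adjoint dot (linfun f) e) => x.
rewrite dotZr -adjointP lfunE /= dotZl mulrCA mulVf ?mulr1//.
by rewrite gt_eqF// dot_gt0.
Qed.

End Dot.

(** * Compactness in coordinates and existence of minimisers *)

Section ExtremeValue.
Context {R : realType} {V : vectType R}.
Variable dot : {dot V for idfun}.
Implicit Types (x y c : V) (S : 'End(V)).

Local Notation n := (\dim {:V}).
Local Notation b := (vbasis {:V}).
Local Notation vec := (passmx.vecof (vbasis {:V})).

Lemma continuous_dot_vecof c : continuous (fun v : 'rV[R]_n => dot c (vec v)).
Proof.
have -> : (fun v : 'rV[R]_n => dot c (vec v)) =
          (fun v => \sum_(i < n) v 0 i * dot c b`_i).
  by apply/funext => v; rewrite dot_sumr; apply: eq_bigr => i _; rewrite dotZr.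
apply: continuous_big => [|i _ v]; first exact: add_continuous.
exact: (cvgM (@coord_continuous R 1 n 0 i v) (cvg_cst (dot c b`_i))).
Qed.

Lemma continuous_quad_vecof S :
  continuous (fun v : 'rV[R]_n => dot (S (vec v)) (vec v)).
Proof.
have -> : (fun v : 'rV[R]_n => dot (S (vec v)) (vec v)) =
          (fun v => \sum_(i < n) v 0 i * dot (S b`_i) (vec v)).
  apply/funext => v; have -> : S (vec v) = \sum_i v 0 i *: S b`_i.
    by rewrite /passmx.vecof linear_sum; apply: eq_bigr => i _; rewrite linearZ.
  rewrite dot_suml.
  by apply: eq_bigr => i _; rewrite dotZl.
apply: continuous_big => [|i _ v]; first exact: add_continuous.
exact: (cvgM (@coord_continuous R 1 n 0 i v) (@continuous_dot_vecof _ v)).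
Qed.

(** The bounds are on the squared norm: [1, 1] gives a unit slice, [0, r] a ball slice. The dual
    cone is an intersection of closed half-spaces, and is [K] itself under self-duality. *)
Definition dual_shell (K : set V) (r1 r2 : R) : set V :=
  [set x | dual_cone dot K x /\ r1 <= dot x x <= r2].

(** The set is closed, being cut out by continuous inequalities; Riesz vectors and Cauchy-Schwarz
    bound its coordinates. *)
Lemma compact_dual_shell (K : set V) (r1 r2 : R) :
  compact (vec @^-1` dual_shell K r1 r2).
Proof.
pose bound i : R := xget 0 [set m | forall x, dot x x <= r2 -> `|coord b i x| <= m].
have boundP i x : dot x x <= r2 -> `|coord b i x| <= bound i.
  move: x; apply: (@xgetPex _ 0 [set m | forall x, dot x x <= r2 -> `|coord b i x| <= m]).
  have [r rE] := coord_riesz dot i.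
  exists (Num.sqrt (r2 * dot r r)) => x xr /=; rewrite rE.
  rewrite -sqrtr_sqr ler_sqrt ?mulr_ge0 ?dot_ge0 ?(le_trans (dot_ge0 dot x))//.
  by rewrite (le_trans (dot_CauchySchwarz _ _ _))// ler_wpM2r ?dot_ge0.
pose box := [set v : 'rV[R]_n |
  forall i, v ord0 i \in `[(- bound i), (bound i)]].
have box_compact : compact box.
  apply: (@rV_compact _ _ (fun i => `[(- bound i), (bound i)]%classic)).
  by move=> i; apply: segment_compact.
apply: subclosed_compact box_compact _; last first.
  move=> v [_ /andP[_ vr]] i /=.
  rewrite in_itv /= -ler_norml.
  by rewrite -(passmx.coord_vecof (vbasisP {:V})) boundP.
pose sq (v : 'rV[R]_n) := dot (\1%VF (vec v)) (vec v).
have -> : vec @^-1` dual_shell K r1 r2 =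
    (\bigcap_(x in K) ((fun v => dot x (vec v)) @^-1` [set t | 0 <= t])) `&`
    (sq @^-1` [set t | r1 <= t] `&` sq @^-1` [set t | t <= r2]).
  apply/seteqP; split => v; rewrite /sq /= id_lfunE.
    by move=> [vK /andP[? ?]]; split => // x /vK.
  by move=> [vK [? ?]]; split; [move=> x /vK|apply/andP].
apply: closedI.
  apply: closed_bigI => x _; apply: preimage_closed; last exact: closed_ge.
  by move=> v _; exact: continuous_dot_vecof.
by apply: closedI; apply: preimage_closed; do ?[exact: closed_ge|exact: closed_le];
  move=> v _; exact: continuous_quad_vecof.
Qed.

Lemma dual_shell_attains_min (K : set V) (r1 r2 : R) S c :
  dual_shell K r1 r2 !=set0 ->
  exists2 x, dual_shell K r1 r2 x &
    forall y, dual_shell K r1 r2 y ->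
      dot (S x) x + dot c x <= dot (S y) y + dot c y.
Proof.
have bV := vbasisP {:V}.
move=> [z Kz]; pose q (v : 'rV[R]_n) := dot (S (vec v)) (vec v) + dot c (vec v).
have A0 : vec @^-1` dual_shell K r1 r2 !=set0.
  by exists (passmx.rVof b z); rewrite /= passmx.rVofK.
have q_cont : {within vec @^-1` dual_shell K r1 r2, continuous q}.
  apply: continuous_subspaceT => v.
  exact: cvgD (@continuous_quad_vecof S v) (@continuous_dot_vecof c v).
have [v] := EVT_min_rV A0 (@compact_dual_shell K r1 r2) q_cont.
rewrite inE => Kv qmin; exists (vec v) => // y Ky.
have := qmin (passmx.rVof b y).
by rewrite inE /= /q passmx.rVofK//; apply.
Qed.

End ExtremeValue.

(** * Self-dual cones, their interior and Moreau's decomposition *)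

(** For a self-dual cone this is membership in the interior, by [cone_intP]. *)
Definition strictly_positive (R : realType) (V : vectType R)
    (dot : {dot V for idfun}) (K : set V) (x : V) :=
  forall y, K y -> y != 0 -> 0 < dot y x.

Section SelfDualCone.
Context {R : realType} {V : vectType R}.
Variables (dot : {dot V for idfun}) (K : set V).
Hypothesis K_self_dual : self_dual dot K.
Implicit Types (x y z u v p : V) (T M : 'End(V)).

Local Notation pos := (strictly_positive dot K).

Lemma self_dual_ge0 x y : K x -> K y -> 0 <= dot x y.
Proof. by move=> Kx; rewrite {1}K_self_dual; apply. Qed.

Lemma self_dualP x : (forall y, K y -> 0 <= dot y x) -> K x.
Proof. by rewrite {2}K_self_dual. Qed.

Lemma self_dual0 : K 0.
Proof. by apply: self_dualP => y _; rewrite dot0r. Qed.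

Lemma self_dualD x y : K x -> K y -> K (x + y).
Proof.
move=> Kx Ky; apply: self_dualP => z Kz.
by rewrite dotDr addr_ge0// self_dual_ge0.
Qed.

Lemma self_dualZ (a : R) x : 0 <= a -> K x -> K (a *: x).
Proof.
move=> a0 Kx; apply: self_dualP => z Kz.
by rewrite dotZr mulr_ge0// self_dual_ge0.
Qed.

Lemma self_dual_normalize y : K y -> y != 0 ->
  exists2 z, dual_shell dot K 1 1 z & y = Num.sqrt (dot y y) *: z.
Proof.
move=> Ky /(dot_gt0 dot) y0; have s0 : 0 < Num.sqrt (dot y y) by rewrite sqrtr_gt0.
exists ((Num.sqrt (dot y y))^-1 *: y); last first.
  by rewrite scalerA divff ?scale1r// gt_eqF.
split; first by rewrite -K_self_dual; apply: self_dualZ => //; rewrite invr_ge0 ltW.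
rewrite dotZl dotZr mulrA -invfM -expr2 sqr_sqrtr ?dot_ge0//.
by rewrite mulVf ?lexx// gt_eqF.
Qed.

Lemma strictly_positive_cone x : pos x -> K x.
Proof.
move=> px; apply: self_dualP => y Ky.
by have [->|/(px _ Ky)/ltW//] := eqVneq y 0; rewrite dot0l.
Qed.

Lemma strictly_positiveD x y : pos x -> K y -> pos (x + y).
Proof.
move=> px Ky z Kz z0; rewrite dotDr ltr_pwDl ?self_dual_ge0//.
exact: px.
Qed.

Lemma strictly_positiveZ (a : R) x : 0 < a -> pos x -> pos (a *: x).
Proof. by move=> a0 px y Ky y0; rewrite dotZr mulr_gt0// px. Qed.

(** Compactness makes the minimum [d] of [<y, x>] over unit [y] in [K] positive; homogeneity does
    the rest. *)
Lemma strictly_positive_gap x : pos x ->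
  exists2 d, 0 < d & forall y, K y -> d * Num.sqrt (dot y y) <= dot y x.
Proof.
move=> px.
have [U0|/set0P U0] := eqVneq (dual_shell dot K 1 1) set0.
  (* Here [K] is [{0}] and any [d] works. *)
  exists 1 => // y Ky; have [->|y0] := eqVneq y 0.
    by rewrite !dot0l sqrtr0 mulr0.
  by have [z] := self_dual_normalize Ky y0; rewrite U0.
have [z [Kz zz] zmin] := dual_shell_attains_min 0 x U0.
have z1 : dot z z = 1 by apply/eqP; rewrite eq_le andbC.
exists (dot z x).
  apply: px; first by rewrite K_self_dual.
  by apply/eqP => z0; move/eqP: z1; rewrite z0 dot0l eq_sym oner_eq0.
move=> y Ky; have [->|y0] := eqVneq y 0; first by rewrite !dot0l sqrtr0 mulr0.
have [w wU yE] := self_dual_normalize Ky y0; rewrite [X in _ <= dot X _]yE.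
rewrite dotZl mulrC ler_wpM2l ?sqrtr_ge0//.
by have := zmin w wU; rewrite !lfunE/= !dot0l !add0r !(dotC dot x).
Qed.

(** If [x] is interior, [x - t *: y] is still in [K] for a small [t > 0], and pairing with [y] gives
    [t <y, y> <= <y, x>]. Conversely the gap [d] is, by Cauchy-Schwarz, the radius of a ball around
    [x] inside [K]. *)
Lemma cone_intP x : cone_int dot K x <-> pos x.
Proof.
rewrite /cone_int /interior /=; split.
  move=> /nbhs_normP [e /= e0 eK] y Ky y0.
  have ny : 0 < `|y : euclid dot| by rewrite normr_gt0.
  pose t := e / 2 / `|y : euclid dot|.
  have t0 : 0 < t by rewrite !divr_gt0.
  have Kxy : K (x - t *: y).
    apply: eK => /=; rewrite opprB addrCA subrr addr0 normrZ gtr0_norm//.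
    by rewrite divfK ?gt_eqF// ltr_pdivrMr// mulr2n mulrDr mulr1 ltrDl.
  have := self_dual_ge0 Ky Kxy; rewrite dotDr dotNr dotZr subr_ge0.
  by apply: lt_le_trans; rewrite mulr_gt0// dot_gt0.
move=> /strictly_positive_gap [d d0 xd]; apply/nbhs_normP; exists d => //= z.
rewrite /= euclid_normE => zd; apply: self_dualP => y Ky.
have := dot_le_sqrt dot y (x - z); have := xd y Ky.
have : Num.sqrt (dot y y) * Num.sqrt (dot (x - z) (x - z)) <=
    Num.sqrt (dot y y) * d by rewrite ler_wpM2l ?sqrtr_ge0// ltW.
by rewrite dotDr dotNr; lra.
Qed.

Lemma strictly_positive_open x u : pos x ->
  exists2 e, 0 < e & forall t, 0 <= t <= e -> pos (x + t *: u).
Proof.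
move=> /strictly_positive_gap [d d0 xd].
have m0 : 0 < 1 + Num.sqrt (dot u u) by rewrite ltr_pwDl ?sqrtr_ge0.
(* The gap [d] absorbs [t *: u] up to this bound; the summand [1] avoids dividing by zero and leaves
   a surplus of [t] times the norm of [y]. *)
exists (d / (1 + Num.sqrt (dot u u))); first by rewrite divr_gt0.
move=> t /andP[t0]; rewrite ler_pdivlMr// => td y Ky y0.
have sy : 0 < Num.sqrt (dot y y) by rewrite sqrtr_gt0 dot_gt0.
have [->|tn0] := eqVneq t 0.
  by rewrite scale0r addr0 (lt_le_trans _ (xd y Ky))// mulr_gt0.
rewrite dotDr dotZr; have := dot_le_sqrt dot (- y) u.
rewrite !dotNl dotNr opprK => yu.
have := ler_wpM2l t0 yu.
have : t * Num.sqrt (dot y y) + t * (Num.sqrt (dot y y) * Num.sqrt (dot u u))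
    <= d * Num.sqrt (dot y y).
  by have := ler_wpM2r (ltW sy) td; lra.
have : 0 < t * Num.sqrt (dot y y) by rewrite mulr_gt0// lt_def tn0.
by have := xd y Ky; lra.
Qed.

(** Write each basis vector as a difference in [K] and sum all the parts. A [y] in [K] orthogonal to
    this sum is orthogonal to every part, hence to the basis. *)
Lemma strictly_positive_exists :
  [set: V] = [set x - y | x in K & y in K] -> exists e, pos e.
Proof.
move=> K_gen; pose b := vbasis {:V}.
have gen x : exists p : V * V, [/\ K p.1, K p.2 & x = p.1 - p.2].
  have : [set: V] x by [].
  by rewrite K_gen => -[u Ku [v Kv <-]]; exists (u, v).
have [f fP] := choice gen.
exists (\sum_(i < \dim {:V}) ((f b`_i).1 + (f b`_i).2)) => y Ky y0.
have term0 (i : 'I_(\dim {:V})) : 0 <= dot y ((f b`_i).1 + (f b`_i).2).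
  by have [? ? _] := fP b`_i; rewrite dotDr addr_ge0// self_dual_ge0.
rewrite dot_sumr lt_def sumr_ge0 ?andbT//.
apply: contra y0; rewrite psumr_eq0// => /allP sum0.
apply/eqP/(dot_eq0 (dot := dot)).
rewrite {2}(coord_vbasis (memvf y)) dot_sumr big1// => i _.
rewrite dotZr; have := sum0 i (mem_index_enum i).
have [K1 K2 bE] := fP b`_i.
have -> : dot y b`_i = dot y (f b`_i).1 - dot y (f b`_i).2.
  by rewrite {1}bE dotDr dotNr.
by rewrite /= dotDr paddr_eq0 ?self_dual_ge0// => /andP[/eqP-> /eqP->]; rewrite subrr mulr0.
Qed.

(* The decomposition is through the metric projection [p] of [x] on [K], which
   minimises [p |-> <p, p> - 2 <x, p>]. *)
Lemma moreau_decomposition x :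
  exists p q, [/\ K p, K q, dot p q = 0 & x = p - q].
Proof.
(* Outside this ball the objective is at least its value [0] at the origin, so a minimum over the
   ball slice is a minimum over [K]. *)
pose r := 4 * dot x x.
have dual0 : dual_shell dot K 0 r !=set0.
  exists 0; split; first by rewrite -K_self_dual; exact: self_dual0.
  by rewrite dot0l lexx mulr_ge0// dot_ge0.
have [p [Kp _] pmin] := dual_shell_attains_min \1%VF (- 2 *: x) dual0.
rewrite -K_self_dual in Kp.
have {}pmin y : K y -> dot p p - 2 * dot x p <= dot y y - 2 * dot x y.
  move=> Ky; have [yr|/ltW yr] := leP (dot y y) r.
    have := pmin y; rewrite !id_lfunE !dotZl !mulNr; apply.
    by split; [rewrite -K_self_dual|rewrite dot_ge0].
  have := pmin 0; rewrite !id_lfunE !dotZl !dot0r mulr0 !mulNr add0r => p0.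
  apply: (@le_trans _ _ 0).
    apply: p0; split; first by rewrite -K_self_dual; exact: self_dual0.
    by rewrite dot0l lexx mulr_ge0// dot_ge0.
  have := dot_ge0 dot (y - 2 *: x).
  by rewrite !(dotDl, dotDr, dotNl, dotNr, dotZl, dotZr) (dotC dot y x) /r in yr *; lra.
(* First order condition in a feasible direction: [z] in [K] gives [p - x] in [K], and [z = - p]
   gives orthogonality. *)
have dir z : (forall t : R, 0 < t < 1 -> K (p + t *: z)) -> 0 <= dot z (p - x).
  move=> Kpz; suff : 0 <= 2 * dot z (p - x) by lra.
  apply: (@affine_ge0 _ _ (dot z z)) => t t01.
  have t0 : 0 < t by case/andP: t01.
  rewrite -(pmulr_rge0 _ t0); have := pmin _ (Kpz t t01).
  rewrite !(dotDl, dotDr, dotNr, dotZl, dotZr) (dotC dot p z) (dotC dot x z); lra.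
have Kq : K (p - x).
  apply: self_dualP => y Ky; apply: dir => t /andP[t0 _].
  by apply: self_dualD => //; apply: self_dualZ => //; exact: ltW.
exists p, (p - x); split => //; last by rewrite opprB addrCA subrr addr0.
apply/eqP; rewrite eq_le (self_dual_ge0 Kp Kq) andbT -oppr_ge0 -dotNl.
apply: dir => t /andP[t0 t1]; rewrite scalerN -{1}(scale1r p) -scalerBl.
by apply: self_dualZ => //; lra.
Qed.

Lemma quasi_monotoneD T T' : quasi_monotone dot K T ->
  cone_nonnegative K T' -> quasi_monotone dot K (T + T').
Proof.
move=> T_QM T'_ge0 x y Kx Ky xy0; rewrite add_lfunE dotDr addr_ge0 ?T_QM//.
by apply: self_dual_ge0 => //; apply: T'_ge0; exists y.
Qed.

Lemma quasi_monotone_adjoint T :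
  quasi_monotone dot K T -> quasi_monotone dot K (adjoint dot T).
Proof.
by move=> QM x y Kx Ky xy0; rewrite -adjointP dotC QM// dotC.
Qed.

(** * Resolvents of a quasi-monotone map *)

Section Resolvent.
Variable T : 'End(V).
Hypothesis T_QM : quasi_monotone dot K T.

(** If [<y, u> = 0] with [y] in [K], quasi-monotonicity gives [<y, T u> >= 0], so
    [<y, s u - T u> <= 0]. *)
Lemma resolvent_boundary (s : R) u : K u -> pos (s *: u - T u) -> pos u.
Proof.
move=> Ku pu y Ky y0; rewrite lt_def self_dual_ge0// andbT.
apply/eqP => yu0; have := pu y Ky y0.
rewrite dotDr dotNr dotZr yu0 mulr0 add0r oppr_gt0 ltNge.
by rewrite T_QM.
Qed.

(* Slide [u] along [v] until it enters [K]: at the entry point it lies on the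
   boundary, which quasi-monotonicity forbids. *)
Lemma resolvent_comparison (s : R) u v :
  pos v -> pos (s *: v - T v) -> K (s *: u - T u) -> K u.
Proof.
move=> pv psv Ksu.
pose E := [set t : R | 0 <= t /\ K (u + t *: v)].
have [e e0 vP] := strictly_positive_open u pv.
have E0 : E !=set0.
  exists e^-1; split; first by rewrite invr_ge0 ltW.
  have -> : u + e^-1 *: v = e^-1 *: (v + e *: u).
    by rewrite scalerDr scalerA mulVf ?scale1r 1?addrC// gt_eqF.
  apply: self_dualZ; first by rewrite invr_ge0 ltW.
  by apply: strictly_positive_cone; apply: vP; rewrite lexx ltW.
have Elb : lbound E 0 by move=> t [].
have Einf : has_inf E by split => //; exists 0.
set t := inf E; have t0 : 0 <= t by apply: lb_le_inf.
(* The infimum is attained: [K] contains some [u + t' *: v] with [t' < t + r] for every [r > 0], and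
   [r] tends to [0]. *)
have Kt : K (u + t *: v).
  apply: self_dualP => y Ky; apply: (@affine_ge0 _ _ (dot y v)) => r /andP[r0 _].
  have [t' [_ Kt'] t'lt] := inf_adherent r0 Einf.
  apply: le_trans (self_dual_ge0 Ky Kt') _.
  rewrite !dotDr !dotZr -addrA lerD2l -mulrDl ler_wpM2r ?(ltW t'lt)//.
  by rewrite self_dual_ge0//; exact: strictly_positive_cone.
move: (t0); rewrite le_eqVlt => /orP[/eqP t00|t_gt0].
  by rewrite -t00 scale0r addr0 in Kt.
(* If [t > 0], this vector is interior, hence so is the entry point, and [t] could be lowered. *)
have pt : pos (s *: (u + t *: v) - T (u + t *: v)).
  have -> : s *: (u + t *: v) - T (u + t *: v) =
      t *: (s *: v - T v) + (s *: u - T u).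
    have -> : T (u + t *: v) = T u + t *: T v by rewrite linearD linearZ.
    by rewrite scalerDr scalerBr !scalerA (mulrC t) opprD addrACA addrC.
  by apply: strictly_positiveD => //; apply: strictly_positiveZ.
have [d d0 dP] := strictly_positive_open (- v) (resolvent_boundary Kt pt).
have m0 : 0 < Num.min d t by rewrite lt_min d0.
have : E (t - Num.min d t).
  split; first by rewrite subr_ge0 ge_min lexx orbT.
  apply: strictly_positive_cone.
  have := dP (Num.min d t); rewrite (ltW m0) ge_min lexx /= => /(_ isT).
  by rewrite scalerN scalerBl addrA.
move=> /(ge_inf (ex_intro _ 0 Elb)); rewrite -/t; lra.
Qed.

(* The infimum of the [s >= 0] admitting [v] in the interior with [s v - T v]
   in the interior is again such an [s]; the condition being open, it is [0]. *)
Lemma resolvent_positive e : pos e ->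
  (forall (s : R) x, 0 <= s -> T x = s *: x -> x = 0) ->
  exists2 v, pos v & pos (- T v).
Proof.
move=> pe noeig.
pose E := [set s : R | 0 <= s /\ exists2 v, pos v & pos (s *: v - T v)].
have E0 : E !=set0.
  have [d d0 dP] := strictly_positive_open (- T e) pe.
  exists d^-1; split; first by rewrite invr_ge0 ltW.
  exists e => //; have -> : d^-1 *: e - T e = d^-1 *: (e + d *: - T e).
    by rewrite scalerDr scalerA mulVf ?scale1r// gt_eqF.
  by apply: strictly_positiveZ; [rewrite invr_gt0|apply: dP; rewrite lexx ltW].
have Elb : lbound E 0 by move=> t [].
have Einf : has_inf E by split => //; exists 0.
set s := inf E; have s0 : 0 <= s by apply: lb_le_inf.
(* [s] is not an eigenvalue, so [s - T] is invertible. *)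
have [u uE] : exists u, s *: u - T u = e.
  pose L := s *: \1%VF - T.
  have LE x : L x = s *: x - T x by rewrite !lfunE /= !lfunE /= id_lfunE.
  have L0 : lker L == 0%VS.
    apply/eqP/vspaceP => x; rewrite memv_ker memv0 LE.
    apply/eqP/eqP => [/eqP|->]; last by rewrite scaler0 linear0 subrr.
    by rewrite subr_eq0 => /eqP/esym/(noeig _ _ s0).
  by exists ((L^-1)%VF e); rewrite -LE lker0_lfunVK.
(* An admissible [s'] close to [s] keeps [s' u - T u] interior, and comparison with its [v] puts [u]
   in [K]. *)
have [d d0 dP] := strictly_positive_open u pe.
have [s' Es' s'lt] := inf_adherent d0 Einf.
have ss' : s <= s' by apply: ge_inf Es'; exists 0.
have [_ [v pv psv]] := Es'.
have ps'u : pos (s' *: u - T u).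
  have -> : s' *: u - T u = e + (s' - s) *: u.
    by rewrite -uE scalerBl addrAC addrCA subrr addr0.
  by apply: dP; rewrite subr_ge0 ss' lerBlDl ltW.
have pu : pos u.
  apply: (resolvent_boundary _ ps'u).
  exact: resolvent_comparison pv psv (strictly_positive_cone ps'u).
move: (s0); rewrite le_eqVlt => /orP[/eqP s00|s_gt0].
  by exists u => //; move: uE; rewrite -s00 scale0r sub0r => ->.
(* As [s u - T u = e] is interior, [s] can be lowered with the same [u], against minimality. *)
have [c c0 cP] := strictly_positive_open (- u) pe.
have m0 : 0 < Num.min c s by rewrite lt_min c0.
have : E (s - Num.min c s).
  split; first by rewrite subr_ge0 ge_min lexx orbT.
  exists u => //.
  have -> : (s - Num.min c s) *: u - T u = e + Num.min c s *: - u.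
    by rewrite -uE scalerBl scalerN addrAC.
  by apply: cP; rewrite (ltW m0) ge_min lexx.
move=> /(ge_inf (ex_intro _ 0 Elb)); rewrite -/s; lra.
Qed.

End Resolvent.

(* Moreau's decomposition and quasi-monotonicity show that the maximum [l] of
   the Rayleigh quotient of [M] is reached at some [c] in [K]. The first order
   condition at [c] in the direction [- p] gives [l <c, p> <= <c, M p> < 0]. *)
Lemma quasi_monotone_neg_definite M p :
  (forall x y, dot (M x) y = dot x (M y)) -> quasi_monotone dot K M ->
  pos p -> pos (- M p) ->
  forall x, x != 0 -> dot (M x) x < 0.
Proof.
move=> M_sym M_QM pp pMp x x0.
have U0 : dual_shell dot K 1 1 !=set0.
  have [a [b [Ka Kb _ xab]]] := moreau_decomposition x.
  have [a0|/(self_dual_normalize Ka)[z zU _]] := eqVneq a 0; last by exists z.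
  have [b0|/(self_dual_normalize Kb)[z zU _]] := eqVneq b 0; last by exists z.
  by rewrite xab a0 b0 subrr eqxx in x0.
have [c [Kc cc] cmin] := dual_shell_attains_min (- M) 0 U0.
have {}cc : dot c c = 1 by apply/eqP; rewrite eq_le andbC.
rewrite -K_self_dual in Kc; pose l := dot (M c) c.
have lK y : K y -> dot (M y) y <= l * dot y y.
  move=> Ky; have [->|y0] := eqVneq y 0; first by rewrite !dot0r mulr0.
  have [z zU yE] := self_dual_normalize Ky y0.
  have := cmin z zU; rewrite !dot0l !addr0 !opp_lfunE !dotNl lerN2 => zl.
  have -> : dot (M y) y = dot y y * dot (M z) z.
    have -> : M y = Num.sqrt (dot y y) *: M z by rewrite {1}yE linearZ.
    by rewrite {3}yE dotZl dotZr mulrA -expr2 sqr_sqrtr ?dot_ge0.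
  by rewrite mulrC ler_wpM2r ?dot_ge0.
(* For [y = a - b] with [a], [b] orthogonal, [<y, y>] splits and the cross term [- 2 <M b, a>] is at
   most [0], so the bound on [K] extends to [V]. *)
have lV y : dot (M y) y <= l * dot y y.
  have [a [b [Ka Kb ab0 ->]]] := moreau_decomposition y.
  have ba : 0 <= dot (M b) a by rewrite M_sym; apply: M_QM => //; rewrite dotC.
  have ab : dot (M a) b = dot (M b) a by rewrite M_sym dotC.
  have -> : M (a - b) = M a - M b by rewrite linearB.
  have := lK a Ka; have := lK b Kb.
  by rewrite !(dotDl, dotDr, dotNl, dotNr) ab (dotC dot b a) ab0; lra.
suff l0 : l < 0.
  by apply: le_lt_trans (lV x) _; rewrite nmulr_rlt0// dot_gt0.
have c0 : c != 0.
  by apply/eqP => c0; move/eqP: cc; rewrite c0 dot0l eq_sym oner_eq0.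
have cp := pp c Kc c0; rewrite -(pmulr_llt0 _ cp).
have := pMp c Kc c0; rewrite dotNr oppr_gt0; apply: le_lt_trans.
(* The bound [lV] at [c - t *: p], divided by [t], is affine in [t], with constant term twice the
   difference to be shown nonnegative. *)
rewrite -subr_ge0 -(pmulr_rge0 _ (ltr0n R 2)).
apply: (@affine_ge0 _ _ (l * dot p p - dot (M p) p)) => t /andP[t0 _].
rewrite -(pmulr_rge0 _ t0); have := lV (c - t *: p).
have -> : M (c - t *: p) = M c - t *: M p by rewrite linearB linearZ.
rewrite !(dotDl, dotDr, dotNl, dotNr, dotZl, dotZr) -/l cc (dotC dot p c).
by rewrite (M_sym c p) (dotC dot (M p) c); lra.
Qed.

End SelfDualCone.

(** * The product cone and the block operator *)

Definition prod_cone (T : Type) (K : set T) : set (T * T) :=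
  [set z | K z.1 /\ K z.2].

Section ProductCone.
Context {R : realType} {V : vectType R}.
Variables (dot : {dot V for idfun}) (K : set V).
Hypothesis K_self_dual : self_dual dot K.

(** The vectors [(x, 0)] and [(0, x)] test the components separately. *)
Lemma self_dual_prod : self_dual (prod_dot dot) (prod_cone K).
Proof.
apply/seteqP; split => [[y1 y2] [/= K1 K2] [x1 x2] [/= X1 X2]|[y1 y2] yP].
  by rewrite /prod_dot /= addr_ge0// (self_dual_ge0 K_self_dual).
have K0 := self_dual0 K_self_dual.
split; apply: (self_dualP K_self_dual) => x Kx.
  have : 0 <= dot x y1 + dot 0 y2 by apply: (yP (x, 0)).
  by rewrite dot0l addr0.
have : 0 <= dot 0 y1 + dot x y2 by apply: (yP (0, x)).
by rewrite dot0l add0r.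
Qed.

Lemma strictly_positive_prod x y :
  strictly_positive dot K x -> strictly_positive dot K y ->
  strictly_positive (prod_dot dot) (prod_cone K) (x, y).
Proof.
move=> px py [u v] [/= Ku Kv]; rewrite xpair_eqE negb_and /prod_dot /= => /orP[n0|n0].
  rewrite ltr_pwDl ?px// (self_dual_ge0 K_self_dual)//.
  exact: (strictly_positive_cone K_self_dual).
rewrite ltr_wpDl ?py// (self_dual_ge0 K_self_dual)//.
exact: (strictly_positive_cone K_self_dual).
Qed.

Variables (A B D Q : 'End(V)).
Hypothesis (D_sa : self_adjoint dot D) (Q_sa : self_adjoint dot Q).

Definition lyapunov_block : 'End((V * V)%type) :=
  block_lfun ((adjoint dot A \o D)%VF + (D \o A)%VF + Q)
    (adjoint dot B \o D)%VF (D \o B)%VF (- Q).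

Lemma lyapunov_blockE x y : lyapunov_block (x, y) =
  (adjoint dot A (D x) + D (A x) + Q x + adjoint dot B (D y), D (B x) - Q y).
Proof. by rewrite block_lfunE /= !add_lfunE !comp_lfunE opp_lfunE. Qed.

Lemma dot_lyapunov_block x y u v :
  prod_dot dot (u, v) (lyapunov_block (x, y)) =
  dot (A u) (D x) + dot (D u) (A x) + dot u (Q x) + dot (B u) (D y) +
  (dot (D v) (B x) - dot v (Q y)).
Proof.
rewrite lyapunov_blockE /prod_dot /= !dotDr dotNr -!adjointP.
by rewrite !(self_adjointP D_sa).
Qed.

Lemma lyapunov_block_sym z w :
  prod_dot dot (lyapunov_block z) w = prod_dot dot z (lyapunov_block w).
Proof.
case: z w => [x y] [u v]; rewrite [LHS](dotC (prod_dot dot)).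
rewrite [LHS]dot_lyapunov_block dot_lyapunov_block.
rewrite !(dotC dot (A x)) !(dotC dot (D x)) !(dotC dot (D y)) !(dotC dot (B x)).
rewrite -(self_adjointP Q_sa u x) -(self_adjointP Q_sa v y).
by rewrite (dotC dot (Q u)) (dotC dot (Q v)); ring.
Qed.

(** Orthogonality in the product holds componentwise. Diffusivity kills the [Q] terms, including the
    one with a minus sign, and makes [D x] orthogonal to [u] and [D u] to [x], so quasi-monotonicity
    of [A] applies. *)
Lemma lyapunov_block_QM : quasi_monotone dot K A -> cone_nonnegative K B ->
  acts_diffusively dot K D -> acts_diffusively dot K Q ->
  quasi_monotone (prod_dot dot) (prod_cone K) lyapunov_block.
Proof.
move=> A_QM B_ge0 [DK D0] [QK Q0] [u v] [x y] [/= Ku Kv] [/= Kx Ky].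
have ge0 := self_dual_ge0 K_self_dual.
have KD w : K w -> K (D w) by move=> Kw; apply: DK; exists w.
have KB w : K w -> K (B w) by move=> Kw; apply: B_ge0; exists w.
rewrite {1}/prod_dot /= => /eqP; rewrite paddr_eq0 ?ge0// => /andP[/eqP ux /eqP vy].
rewrite dot_lyapunov_block (Q0 u x)// (Q0 v y)// addr0 subr0.
have AD : 0 <= dot (A u) (D x).
  by rewrite dotC; apply: A_QM => //; [exact: KD|rewrite dotC D0].
have DA : 0 <= dot (D u) (A x).
  by apply: A_QM => //; [exact: KD|rewrite (self_adjointP D_sa) D0].
have BD : 0 <= dot (B u) (D y) by apply: ge0; [exact: KB|exact: KD].
have DB : 0 <= dot (D v) (B x) by apply: ge0; [exact: KD|exact: KB].
by rewrite !addr_ge0.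
Qed.

End ProductCone.

(** * Choice of [D] and [Q] *)

Theorem proposition3p8 (R : realType) (V : vectType R)
    (dot : {dot V for idfun}) (A B : 'End(V)) (K : set V)
    (K_proper : proper_cone dot K) (K_self_dual : self_dual dot K)
    (K_diffusive : forall v w : V, cone_int dot K v -> cone_int dot K w ->
       exists D : 'End(V),
         [/\ self_adjoint dot D, acts_diffusively dot K D & D v = w])
    (A_QM : quasi_monotone dot K A)
    (B_nonneg : cone_nonnegative K B)
    (AB_stable : stable (A + B)) :
  exists D Q : 'End(V),
    [/\ acts_diffusively dot K D,
        acts_diffusively dot K Q &
        neg_definite (prod_dot dot)
          (block_lfun ((adjoint dot A \o D)%VF + (D \o A)%VF + Q)
                      (adjoint dot B \o D)%VF
                      (D \o B)%VF
                      (- Q))].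
Proof.
have intP := cone_intP K_self_dual.
have [_ _ _ /(strictly_positive_exists K_self_dual) [e pe]] := K_proper.
have T_QM := quasi_monotoneD K_self_dual A_QM B_nonneg.
set T := A + B in T_QM AB_stable.
have noeig (s : R) x : 0 <= s -> T x = s *: x -> x = 0.
  move=> s0 Tx; apply/eqP/negPn/negP => /(real_eigenvector_lt0 AB_stable Tx).
  by rewrite ltNge s0.
(* [T - s] is onto, so [x = (T - s) z] and [<x, x> = <z, (T' - s) x> = 0], with [T'] the adjoint of
   [T]. *)
have noeig_adj (s : R) x : 0 <= s -> adjoint dot T x = s *: x -> x = 0.
  move=> s0 Tx; pose L := T - s *: \1%VF.
  have LE y : L y = T y - s *: y by rewrite !lfunE /= !lfunE /= lfunE /= id_lfunE.
  have L0 : lker L == 0%VS.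
    apply/eqP/vspaceP => y; rewrite memv_ker memv0 LE.
    apply/eqP/eqP => [/eqP|->]; last by rewrite scaler0 linear0 subrr.
    by rewrite subr_eq0 => /eqP/(noeig _ _ s0).
  apply: (dot_eq0 (dot := dot)); rewrite -{1}(lker0_lfunVK L0 x) LE.
  by rewrite dotDl dotNl adjointP Tx dotZl dotZr subrr.
have [v pv pTv] := resolvent_positive K_self_dual T_QM pe noeig.
have [w pw pTw] := resolvent_positive K_self_dual
  (quasi_monotone_adjoint T_QM) pe noeig_adj.
have [D [D_sa D_diff Dv]] := K_diffusive v w (proj2 (intP v) pv) (proj2 (intP w) pw).
pose u := - adjoint dot T w + D (- T v).
have pu : strictly_positive dot K u.
  apply: (strictly_positiveD K_self_dual) => //.
  case: D_diff => DK _; apply: DK; exists (- T v) => //.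
  exact: (strictly_positive_cone K_self_dual).
have phu : strictly_positive dot K (2^-1 *: u).
  by apply: strictly_positiveZ => //; rewrite invr_gt0 ltr0n.
(* With this value of [Q v], both components of the block operator at [(v, v)] equal [- u / 2]: the
   second is [D (B v) - Q v], and the two add up to [- u]. *)
have pq : strictly_positive dot K (2^-1 *: u + D (B v)).
  apply: (strictly_positiveD K_self_dual) => //.
  case: D_diff => DK _; apply: DK; exists (B v) => //.
  apply: B_nonneg; exists v => //.
  exact: (strictly_positive_cone K_self_dual).
have [Q [Q_sa Q_diff Qv]] := K_diffusive v _ (proj2 (intP v) pv) (proj2 (intP _) pq).
exists D, Q; split => //; rewrite -/(lyapunov_block dot A B D Q).
have M_sym := lyapunov_block_sym A B D_sa Q_sa.
split; first exact: adjoint_unique.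
apply: (quasi_monotone_neg_definite (self_dual_prod K_self_dual) (p := (v, v))).
- exact: M_sym.
- exact: lyapunov_block_QM.
- exact: strictly_positive_prod.
have -> : - lyapunov_block dot A B D Q (v, v) = (2^-1 *: u, 2^-1 *: u).
  rewrite lyapunov_blockE Dv Qv; congr pair => /=; last first.
    by rewrite opprB addrK.
  rewrite -[RHS](addrK (2^-1 *: u)) -scalerDl.
  have -> : 2^-1 + 2^-1 = 1 :> R by lra.
  have uE : u = - (adjoint dot A w + adjoint dot B w + (D (A v) + D (B v))).
    have DT : D (- T v) = - (D (A v) + D (B v)).
      by rewrite -linearD -add_lfunE linearN.
    by rewrite /u DT adjointD add_lfunE -opprD.
  rewrite scale1r {2}uE -opprD; congr (- _).
  by rewrite (AC (2*2*1) ((1*5)*(2*4)*3)).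
exact: strictly_positive_prod.
Qed.
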